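(* Let $l\in\mathbb{Z}_{>0}$, let $\boldsymbol{\lambda}=(\lambda^0,\ldots,\lambda^{l-1})$ be an $l$-partition, let $\mathbf{s}=(s_0,\ldots,s_{l-1})\in\mathbb{Z}^l$ and let $e\in\mathbb{Z}_{>1}$. Then the $e$-weight $p_{(e,\mathbf{s})}(\boldsymbol{\lambda})$ of $\boldsymbol{\lambda}$ is equal to the $e$-defect of $\boldsymbol{\lambda}$ attached to $\mathbf{s}$, that is, to the number of charged hook lengths in the multiset $H(\boldsymbol{\lambda})$ (counted with multiplicity) that are congruent to $0$ modulo $e$.
   Context: A partition $\lambda=(\lambda_1\ge\lambda_2\ge\cdots)$ has set of nodes $[\lambda]=\{(i,j):i\ge1,\ 1\le j\le\lambda_i\}$ and conjugate partition $\lambda'$ with $\lambda'_k=\sharp\{i\ge1:\lambda_i\ge k\}$. An $l$-partition is an $l$-tuple of partitions. **Charged hook lengths.** For $a,b\in\{0,\ldots,l-1\}$ and $(c,d)\in[\lambda^a]$, the $\mathbf{s}$-charged hook length of $(c,d)$ with respect to $(\lambda^a,\lambda^b)$ is $$ch_{c,d}^{\lambda^a,\lambda^b}=\lambda^a_c-c+(\lambda^b)'_d-d+1+s_a-s_b .$$ $H(\boldsymbol{\lambda})$ is the multiset $\{ch_{c,d}^{\lambda^a,\lambda^b}: a,b\in\{0,\ldots,l-1\},\ (c,d)\in[\lambda^a]\}$. **Weight (Fayers).** For $i\in\mathbb{Z}/e\mathbb{Z}$, let $c_i^{e,\mathbf{s}}(\boldsymbol{\lambda})$ be the number of nodes of $\boldsymbol{\lambda}$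 (a node $(x,y)\in[\lambda^a]$ in component $a$) whose charged content $y-x+s_a$ is congruent to $i$ modulo $e$. The $e$-weight of $\boldsymbol{\lambda}$ attached to $(e,\mathbf{s})$ is $$p_{(e,\mathbf{s})}(\boldsymbol{\lambda})=\sum_{0\le i\le l-1}c^{e,\mathbf{s}}_{s_i}(\boldsymbol{\lambda})-\frac12\sum_{i\in\mathbb{Z}/e\mathbb{Z}}\big(c_i^{e,\mathbf{s}}(\boldsymbol{\lambda})-c_{i-1}^{e,\mathbf{s}}(\boldsymbol{\lambda})\big)^2,$$ where the index $s_i$ is read modulo $e$. *)

(* Defs.v *)
From HB Require Import structures.
From mathcomp Require Import all_boot all_order all_algebra.

Set Implicit Arguments.
Unset Strict Implicit.
Unset Printing Implicit Defensive.

Import Order.TTheory GRing.Theory Num.Theory.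
Local Open Scope ring_scope.

(* A partition is the list of its nonzero parts, in weakly decreasing order. *)
Record intpart := IntPart {
  parts :> seq nat;
  partsP : sorted geq parts && (0%N \notin parts)
}.

(* Rows are numbered from 1; the argument 0 is never used. *)
Definition part (la : intpart) (i : nat) : nat := nth 0%N la i.-1.

(* The list ranges over the nonzero parts only, which agrees with
   #{i >= 1 : la_i >= k} for k >= 1; the argument 0 is never used. *)
Definition conj_part (la : intpart) (k : nat) : nat := count (leq k) la.

Definition nodes (la : intpart) : seq (nat * nat) :=
  [seq (i, j) | i <- iota 1 (size la), j <- iota 1 (part la i)].

Lemma mem_nodes (la : intpart) (i j : nat) :
  ((i, j) \in nodes la) = [&& (0 < i)%N, (0 < j)%N & (j <= part la i)%N].
Proof.
apply/allpairsPdep/and3P => [[x [y []]]|[i0 j0 jl]].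
  by rewrite !mem_iota => /andP[x0 _] /andP[y0 yl] [-> ->].
exists i, j; split=> //; last by rewrite mem_iota j0 add1n ltnS.
rewrite mem_iota i0 add1n ltnS leqNgt; apply/negP => szi.
have := leq_trans j0 jl; rewrite /part nth_default //.
by case: i szi {i0 jl} => // i; rewrite ltnS.
Qed.

Lemma uniq_nodes (la : intpart) : uniq (nodes la).
Proof.
apply: allpairs_uniq_dep => [|x _|]; rewrite ?iota_uniq //.
by move=> [x y] [x' y'] /= _ _ [-> ->].
Qed.

Section MultiPartitions.
Variables (l : nat) (s : 'I_l -> int) (la : 'I_l -> intpart).

Definition charged_hook (a b : 'I_l) (n : nat * nat) : int :=
  (part (la a) n.1)%:Z - n.1%:Z + (conj_part (la b) n.2)%:Z - n.2%:Z + 1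
  + s a - s b.

(* A multiset, listed with multiplicity; the order is irrelevant. *)
Definition charged_hooks : seq int :=
  [seq charged_hook ab.1 ab.2 n
     | ab <- enum {: 'I_l * 'I_l}, n <- nodes (la ab.1)].

Definition defect (e : nat) : nat :=
  count (fun h => (h == 0 %[mod e])%Z) charged_hooks.

Definition charged_content (a : 'I_l) (n : nat * nat) : int :=
  n.2%:Z - n.1%:Z + s a.

(* 'Z_e is the ring of integers modulo e only for e > 1. *)
Definition residue_count (e : nat) (i : 'Z_e) : nat :=
  (\sum_(a < l)
     count (fun n => ((charged_content a n)%:~R : 'Z_e) == i) (nodes (la a)))%N.

Definition weight (e : nat) : rat :=
  (\sum_(a < l) (residue_count ((s a)%:~R : 'Z_e))%:R)
  - 2%:R^-1 * \sum_(i : 'Z_e)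
      ((residue_count i)%:R - (residue_count (i - 1))%:R) ^+ 2.

End MultiPartitions.

(* Main.v *)
Require Import Defs.
From mathcomp Require Import all_boot all_order all_algebra all_field.
From mathcomp Require Import ring zify.

Set Implicit Arguments.
Unset Strict Implicit.
Unset Printing Implicit Defensive.

Import Order.TTheory GRing.Theory Num.Theory.
Local Open Scope ring_scope.

(** Both sides are numbers of coincidences modulo e between integers, so they
can be compared by Fourier analysis on the cyclic group of order e.  For a
number q, encode a multiset of integers by the sum of the powers q ^ x of its
members.  Let S(q), C(q) and H(q) encode the charges, the charged contents and
the charged hook lengths.  The heart of the proof is an identity that knows
nothing of e (power_sum_hooks_reciprocity):

  H(q) + H(1/q) = S(q) C(1/q) + C(q) S(1/q) - (1 - q) (1 - 1/q) C(q) C(1/q).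

Expanding the sums over the components reduces it to a statement on a pair of
partitions (hook_sum_reciprocity), proved by deleting the first column from
both partitions at once.  This deletion does not change the hook length of
any surviving node: in one partition the length of its row and its
column index both drop by one, and the column of the other partition keeps
its height.  What the deleted columns contribute is then evaluated with
geometric sums.

Now let q run over the e-th roots of unity, where q ^ x depends only on x
modulo e: a power sum becomes the Fourier transform of the function counting
the members of each residue class, and multiplying by 1 - q turns the residue
counts c_i into the differences c_i - c_(i-1).  Summing the identity over all
q, Parseval gives e times

  2 defect = 2 (sum of c_(s_a) over the components a)
             - (sum of (c_i - c_(i-1)) ^ 2 over the residues i),

which is twice the claim.  The roots of unity live in the algebraic numbers,
hence the embedding of the rationals there at the end. *)

(** * Reciprocity for the hooks of two partitions *)

(** Here and below a partition is a weakly decreasing list in which zero parts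
are allowed, so that deleting a column is map predn and keeps the number of
rows.  Rows and columns are numbered from 0, which leaves contents unchanged
and accounts for the final - 1 in the hook length. *)

Definition hook_sum (F : fieldType) (q : F) (r t : seq nat) : F :=
  \sum_(0 <= i < size r) \sum_(0 <= j < nth 0%N r i)
    q ^ ((nth 0%N r i)%:Z - i%:Z + (count (leq j.+1) t)%:Z - j%:Z - 1).

Definition content_sum (F : fieldType) (q : F) (r : seq nat) : F :=
  \sum_(0 <= i < size r) \sum_(0 <= j < nth 0%N r i) q ^ (j%:Z - i%:Z).

Lemma sorted_map_predn (r : seq nat) :
  sorted geq r -> sorted geq (map predn r).
Proof. by apply: homo_sorted => x y /=; lia. Qed.

Lemma count_predn (r : seq nat) j :
  count (leq j.+1) (map predn r) = count (leq j.+2) r.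
Proof. by rewrite count_map; apply: eq_count => x /=; lia. Qed.

Lemma nth_gt0_sorted (r : seq nat) i :
  sorted geq r -> (0 < nth 0%N r i)%N = (i < count (leq 1) r)%N.
Proof.
elim: r i => [|x r IH] i //=; first by rewrite nth_nil.
rewrite path_sortedE; last by move=> a b c /=; lia.
case/andP=> /allP x_ge r_sorted.
case: x => [|x] in x_ge *; last by case: i => [|i] //=; rewrite IH.
have r0 : count (leq 1) r = 0%N.
  by apply/eqP; rewrite -leqn0 leqNgt -has_count; apply/hasP=> -[y /x_ge /=]; lia.
by case: i => [|i] /=; rewrite ?r0 // IH // r0.
Qed.

(** Weak monotonicity puts the nonempty rows at the top, so the first column
occupies the rows numbered below its height count (leq 1) r. *)
Lemma sum_rows_first_column (V : nmodType) (r : seq nat) (f : nat -> nat -> V) :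
  sorted geq r ->
  \sum_(0 <= i < size r) \sum_(0 <= j < nth 0%N r i) f i j
  = \sum_(0 <= i < count (leq 1) r) f i 0%N
    + \sum_(0 <= i < size (map predn r))
        \sum_(0 <= j < nth 0%N (map predn r) i) f i j.+1.
Proof.
move=> r_sorted; rewrite size_map.
rewrite (big_nat_widen _ _ _ _ _ (count_size (leq 1) r)).
rewrite [X in X + _]big_mkcond -big_split /=.
apply: eq_big_nat => i /andP[_ lt_i_r].
rewrite (nth_map 0%N) // -nth_gt0_sorted //.
by case: (nth _ r i) => [|p]; rewrite ?big_nat_recl //= !big_geq // addr0.
Qed.

Section FirstColumn.
Variables (F : fieldType) (q : F).
Hypothesis q_neq0 : q != 0.

Let qD (m n : int) : q ^ (m + n) = q ^ m * q ^ n.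
Proof. exact: expfzDr. Qed.

(** The nodes outside the first column keep their hook lengths when the first
column of both partitions is deleted. *)
Lemma hook_sum_first_column (r t : seq nat) : sorted geq r ->
  hook_sum q r t
  = q ^+ count (leq 1) t
      * \sum_(0 <= i < count (leq 1) r) q ^ ((nth 0%N r i)%:Z - i%:Z - 1)
    + hook_sum q (map predn r) (map predn t).
Proof.
move=> r_sorted; rewrite /hook_sum sum_rows_first_column //; congr (_ + _).
  rewrite big_distrr /=; apply: eq_bigr => i _.
  by rewrite exprnP -qD; congr (q ^ _); lia.
rewrite size_map; apply: eq_big_nat => i /andP[_ lt_i_r].
apply: eq_big_nat => j; rewrite (nth_map 0%N) // => /andP[_ lt_j].
by rewrite count_predn; congr (q ^ _); lia.
Qed.

Lemma content_sum_first_column (r : seq nat) : sorted geq r ->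
  content_sum q r
  = \sum_(0 <= i < count (leq 1) r) q ^ (- i%:Z)
    + q * content_sum q (map predn r).
Proof.
move=> r_sorted; rewrite /content_sum sum_rows_first_column //; congr (_ + _).
  by apply: eq_bigr => i _; rewrite sub0r.
rewrite big_distrr; apply: eq_bigr => i _; rewrite big_distrr /=.
by apply: eq_bigr => j _; rewrite -{2}[q]expr1z -qD; congr (q ^ _); lia.
Qed.

(** The contents in a row are consecutive integers, so the factor q - 1
leaves one boundary term at each end of the row. *)
Lemma content_sum_telescope (r : seq nat) : sorted geq r ->
  (q - 1) * content_sum q (map predn r)
  = \sum_(0 <= i < count (leq 1) r) q ^ ((nth 0%N r i)%:Z - i%:Z - 1)
    - \sum_(0 <= i < count (leq 1) r) q ^ (- i%:Z).
Proof.
move=> r_sorted; rewrite -sumrB /content_sum size_map.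
rewrite (big_nat_widen _ _ _ _ _ (count_size (leq 1) r)) [RHS]big_mkcond /=.
rewrite big_distrr /=; apply: eq_big_nat => i /andP[_ lt_i_r].
rewrite (nth_map 0%N) // -nth_gt0_sorted //.
case: (nth _ r i) => [|p] /=; first by rewrite big_geq // mulr0.
rewrite (_ : q ^ (p.+1%:Z - _ - 1) = q ^ (p%:Z - i%:Z)); last first.
  by congr (q ^ _); lia.
rewrite big_distrr /= -[X in _ = _ - X](_ : q ^ (0%:Z - i%:Z) = _); last
  by rewrite sub0r.
rewrite -(telescope_sumr (fun j : nat => q ^ (j%:Z - i%:Z))) //.
apply: eq_bigr => j _; rewrite mulrBl mul1r -{1}[q]expr1z -qD.
by congr (q ^ _ - _); lia.
Qed.

Lemma geometric_sum n : q ^- n = 1 - (1 - q^-1) * \sum_(0 <= i < n) q ^ (- i%:Z).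
Proof.
elim: n => [|n IH]; first by rewrite big_geq // mulr0 subr0 expr0 invr1.
rewrite big_nat_recr //= mulrDr opprD addrA -IH exprS invfM -invr_expz -exprnP.
by ring.
Qed.

End FirstColumn.

(** After deletion of the first columns every term is a polynomial in the two
column sums of powers of q, the content sums and the hook sums of the smaller
partitions; the content sums telescope, the powers of q given by the column
heights are geometric sums, and the induction hypothesis removes one hook
sum, leaving an identity of rational functions in independent variables. *)
Lemma hook_sum_reciprocity (F : fieldType) (q : F) (r t : seq nat) :
  q != 0 -> sorted geq r -> sorted geq t ->
  hook_sum q r t + hook_sum q^-1 t r
  = content_sum q r + content_sum q^-1 t
    - (1 - q) * (1 - q^-1) * content_sum q r * content_sum q^-1 t.
Proof.
move=> q0; have q'0 : q^-1 != 0 by rewrite invr_neq0.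
(* k bounds the number of columns; one is deleted at each step. *)
have [k] : exists k, all (geq k) (r ++ t).
  exists (\max_(x <- r ++ t) x)%N; apply/allP => x x_in /=.
  exact: (@leq_bigmax_seq _ _ xpredT id).
rewrite all_cat; elim: k => [|k IH] in r t * => /andP[r_le t_le] r_sorted t_sorted.
  have zero (u : seq nat) (f : nat -> nat -> F) : all (geq 0%N) u ->
      \sum_(0 <= i < size u) \sum_(0 <= j < nth 0%N u i) f i j = 0.
    move=> /allP u0; rewrite big_nat big1 // => i /andP[_ lt_i].
    by rewrite big_geq //; apply: u0; rewrite mem_nth.
  by rewrite /hook_sum /content_sum !zero //; ring.
have step (u : seq nat) : all (geq k.+1) u -> all (geq k) (map predn u).
  by rewrite all_map; apply: sub_all => x /=; lia.
have := IH (map predn r) (map predn t).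
rewrite !step // !sorted_map_predn // => /(_ isT isT isT).
have Er := content_sum_telescope q0 r_sorted.
have Et := content_sum_telescope q'0 t_sorted.
have Gr := geometric_sum q (count (leq 1) r).
have Gt := geometric_sum q^-1 (count (leq 1) t).
rewrite -exprVn invrK in Gt; rewrite -exprVn in Gr.
rewrite (hook_sum_first_column q0 t r_sorted) (hook_sum_first_column q'0 r t_sorted).
rewrite (content_sum_first_column q0 r_sorted) (content_sum_first_column q'0 t_sorted).
(* Solve for the powers of q, then for the sums over the row ends. *)
move: Gr Gt Er Et; move: (q ^+ _) (q^-1 ^+ _) => qt qr -> -> /eqP.
rewrite eq_sym subr_eq => /eqP ->.
move=> /eqP; rewrite eq_sym subr_eq => /eqP ->.
move: (content_sum _ _) (content_sum _ _) (hook_sum _ _ _) (hook_sum _ _ _) => v w h h'.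
move=> /eqP; rewrite eq_sym -subr_eq => /eqP <-.
by field.
Qed.

(** * Power sums of a multipartition *)

Lemma sum_nodes (V : nmodType) (la : intpart) (f : nat * nat -> V) :
  \sum_(n <- nodes la) f n
  = \sum_(0 <= i < size la) \sum_(0 <= j < nth 0%N la i) f (i.+1, j.+1).
Proof.
rewrite /nodes big_allpairs_dep /= -[1%N]addn0 iotaDl big_map.
rewrite /index_iota subn0; apply: eq_bigr => i _.
by rewrite iotaDl big_map /index_iota subn0.
Qed.

Section ChargedSums.
Variables (F : fieldType) (l : nat) (s : 'I_l -> int) (la : 'I_l -> intpart).

Definition charged_contents : seq int :=
  flatten [seq [seq charged_content s a n | n <- nodes (la a)] | a <- enum 'I_l].

Definition charges : seq int := [seq s a | a <- enum 'I_l].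

Definition power_sum (q : F) (xs : seq int) : F := \sum_(x <- xs) q ^ x.

Lemma power_sum_charges q : power_sum q charges = \sum_(a < l) q ^ s a.
Proof. by rewrite /power_sum big_map big_enum. Qed.

Lemma power_sum_contents q : q != 0 ->
  power_sum q charged_contents = \sum_(a < l) q ^ s a * content_sum q (la a).
Proof.
move=> q0; rewrite /power_sum big_flatten big_map big_enum /=.
apply: eq_bigr => a _; rewrite big_map sum_nodes big_distrr /=.
apply: eq_bigr => i _; rewrite big_distrr; apply: eq_bigr => j _ /=.
by rewrite -expfzDr // /charged_content /=; congr (q ^ _); lia.
Qed.

Lemma power_sum_hooks q : q != 0 ->
  power_sum q (charged_hooks s la)
  = \sum_(a < l) \sum_(b < l) q ^ s a * q^-1 ^ s b * hook_sum q (la a) (la b).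
Proof.
move=> q0; rewrite /power_sum /charged_hooks big_allpairs_dep big_enum /=.
rewrite pair_big; apply: eq_bigr => -[a b] _ /=.
rewrite sum_nodes big_distrr /=; apply: eq_bigr => i _.
rewrite big_distrr; apply: eq_bigr => j _ /=; rewrite exprz_inv -!expfzDr //.
by rewrite /charged_hook /part /conj_part /=; congr (q ^ _); lia.
Qed.

(** The hooks of (a, b) at q are paired with those of (b, a) at the inverse of
q; the shifts s a - s b and s b - s a then give the same power of q. *)
Lemma power_sum_hooks_reciprocity q : q != 0 ->
  power_sum q (charged_hooks s la) + power_sum q^-1 (charged_hooks s la)
  = power_sum q charges * power_sum q^-1 charged_contents
    + power_sum q charged_contents * power_sum q^-1 charges
    - ((1 - q) * power_sum q charged_contents)
      * ((1 - q^-1) * power_sum q^-1 charged_contents).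
Proof.
move=> q0; have q'0 : q^-1 != 0 by rewrite invr_neq0.
rewrite !power_sum_hooks // !power_sum_contents // !power_sum_charges invrK.
rewrite [X in _ + X]exchange_big -big_split /=.
have combine (A B D : 'I_l -> 'I_l -> F) (k : F) :
    (\sum_a \sum_b A a b) + (\sum_a \sum_b B a b) - k * (\sum_a \sum_b D a b)
    = \sum_a \sum_b (A a b + B a b - k * D a b).
  rewrite -big_split mulr_sumr -sumrB; apply: eq_bigr => a _ /=.
  by rewrite -big_split mulr_sumr -sumrB.
rewrite [in RHS]mulrACA !big_distrlr combine.
apply: eq_bigr => a _; rewrite -big_split; apply: eq_bigr => b _ /=.
have sorted_la c : sorted geq (la c) by case/andP: (partsP (la c)).
rewrite [q^-1 ^ _ * q ^ _]mulrC -mulrDr hook_sum_reciprocity //.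
by ring.
Qed.

End ChargedSums.

(** * Fourier analysis on the residues modulo e *)

Section Fourier.
Variables (e : nat) (F : fieldType).
Hypothesis e_gt1 : (1 < e)%N.

Lemma sum_by_residue (f : 'Z_e -> F) (xs : seq int) :
  \sum_(x <- xs) f x%:~R
  = \sum_(i : 'Z_e) (count (fun x : int => x%:~R == i) xs)%:R * f i.
Proof.
rewrite (partition_big (fun x : int => x%:~R : 'Z_e) xpredT) //=.
apply: eq_bigr => i _; rewrite -sum1_count natr_sum big_distrl /=.
by apply: eq_bigr => x /eqP ->; rewrite mul1r.
Qed.

Lemma unity_neq0 (q : F) : q ^+ e = 1 -> q != 0.
Proof.
apply: contra_eq_neq => ->.
by rewrite expr0n gtn_eqF ?(ltnW e_gt1) //= eq_sym oner_eq0.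
Qed.

Lemma unity_exprZ_D (q : F) (i j : 'Z_e) : q ^+ e = 1 ->
  q ^+ (i + j)%R = q ^+ i * q ^+ j.
Proof. by move=> qe; rewrite -exprD /= expr_mod // Zp_cast. Qed.

(** Negative exponents follow from the positive ones because the exponent map
on residues is additive. *)
Lemma unity_exprz (q : F) (x : int) : q ^+ e = 1 ->
  q ^ x = q ^+ (x%:~R : 'Z_e).
Proof.
move=> qe.
have pos n : q ^+ n = q ^+ (n%:R : 'Z_e) by rewrite val_Zp_nat // expr_mod.
case: x => n; first exact: pos.
have unit_q m : q ^+ m != 0 by rewrite expf_neq0 // unity_neq0.
rewrite NegzE -exprz_inv -exprnP exprVn; apply: (mulfI (unit_q n.+1)).
by rewrite divff // pos -unity_exprZ_D // mulrNz subrr.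
Qed.

Lemma power_sum_residues (q : F) (xs : seq int) : q ^+ e = 1 ->
  power_sum q xs
  = \sum_(i : 'Z_e) (count (fun x : int => x%:~R == i) xs)%:R * q ^+ i.
Proof.
move=> qe; rewrite -(sum_by_residue (fun i => q ^+ i)).
by apply: eq_bigr => x _; exact: unity_exprz.
Qed.

(** Multiplying by q translates the coefficients by one residue. *)
Lemma mul_1Bq_residues (q : F) (c : 'Z_e -> F) : q ^+ e = 1 ->
  (1 - q) * (\sum_(i : 'Z_e) c i * q ^+ i)
  = \sum_(i : 'Z_e) (c i - c (i - 1)) * q ^+ i.
Proof.
move=> qe; rewrite mulrBl mul1r.
under [RHS]eq_bigr do rewrite mulrBl.
rewrite sumrB; congr (_ - _).
rewrite [RHS](reindex_inj (addIr (1 : 'Z_e))) big_distrr.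
apply: eq_bigr => i _; rewrite addrK unity_exprZ_D //.
by rewrite (_ : (1 : 'Z_e) = 1%N :> nat) //= expr1 mulrCA [q * _]mulrC.
Qed.

Lemma root_of_unity_sum (w : F) : w ^+ e = 1 -> w != 1 ->
  \sum_(k < e) w ^+ k = 0.
Proof.
move=> we w1; apply: (mulfI (x := w - 1)); first by rewrite subr_eq0.
by rewrite -subrX1 we subrr mulr0.
Qed.

(** For i different from j, the sum over k of the powers of z ^ i / z ^ j is a
full geometric sum of a nontrivial root of unity and vanishes; only the
diagonal terms survive. *)
Lemma Parseval (z : F) (x y : 'Z_e -> F) : e.-primitive_root z ->
  \sum_(k < e) (\sum_(i : 'Z_e) x i * (z ^+ k) ^+ i)
               * (\sum_(j : 'Z_e) y j * (z ^+ k)^-1 ^+ j)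
  = e%:R * \sum_(i : 'Z_e) x i * y i.
Proof.
move=> z_prim; have ze := prim_expr_order z_prim.
have z0 := unity_neq0 ze.
under eq_bigr do rewrite big_distrlr /=.
rewrite exchange_big big_distrr /=; apply: eq_bigr => i _.
rewrite exchange_big (bigD1 i) //= [X in _ + X]big1 ?addr0 => [|j ji].
  rewrite (eq_bigr (fun=> x i * y i)) => [|k _].
    by rewrite sumr_const card_ord mulr_natl.
  by rewrite exprVn mulrACA divff ?mulr1 // !expf_neq0.
rewrite (eq_bigr (fun k : 'I_e => x i * y j * (z ^+ i / z ^+ j) ^+ k)).
  rewrite -big_distrr /= root_of_unity_sum ?mulr0 //.
    by rewrite expr_div_n -!exprM ![(_ * e)%N]mulnC !exprM ze !expr1n divr1.
  rewrite -subr_eq0 -[1](divff (expf_neq0 j z0)) -mulrBl mulf_eq0 invr_eq0.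
  rewrite (expf_eq0 _ j) (negPf z0) andbF orbF subr_eq0 (eq_prim_root_expr z_prim).
  have lt_e (m : 'Z_e) : (m < e)%N by rewrite -[X in (_ < X)%N](Zp_cast e_gt1).
  by rewrite !modn_small // eq_sym.
move=> k _; rewrite exprVn -!exprM ![(k * _)%N]mulnC !exprM.
by rewrite expr_div_n mulrACA.
Qed.

End Fourier.

(** * The weight as a sum over roots of unity *)

Lemma intr_Zp_eq0 (e : nat) (x : int) : (1 < e)%N ->
  (x%:~R == 0 :> 'Z_e) = (x == 0 %[mod e])%Z.
Proof.
move=> e_gt1; rewrite eqz_mod_dvd subr0.
have nat_case n : (n%:R == 0 :> 'Z_e) = (e %| n)%N.
  by rewrite -val_eqE /= val_Zp_nat.
case: x => n; first exact: nat_case.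
by rewrite NegzE mulrNz oppr_eq0 dvdzE abszN; exact: nat_case.
Qed.

Lemma residue_countE (l e : nat) (s : 'I_l -> int) (la : 'I_l -> intpart) i :
  residue_count s la i
  = count (fun x : int => (x%:~R : 'Z_e) == i) (charged_contents s la).
Proof.
rewrite /residue_count /charged_contents count_flatten -map_comp sumnE big_map.
by rewrite big_enum; apply: eq_bigr => a _; rewrite /= count_map.
Qed.

Theorem theorem3p7p1 (l : nat) (l_gt0 : (0 < l)%N)
    (la : 'I_l -> intpart) (s : 'I_l -> int) (e : nat) (e_gt1 : (1 < e)%N) :
  weight s la e = (defect s la e)%:R :> rat.
Proof.
have [z z_prim] := C_prim_root_exists (ltnW e_gt1).
have qe (k : 'I_e) : (z ^+ k) ^+ e = 1.
  by rewrite -exprM mulnC exprM (prim_expr_order z_prim) expr1n.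
have qVe (k : 'I_e) : (z ^+ k)^-1 ^+ e = 1 by rewrite exprVn qe invr1.
have q0 k := unity_neq0 e_gt1 (qe k).
(* Coefficient functions of the residue classes; the transform of one is the
   constant 1, which makes the number of hooks in class 0 a scalar product. *)
pose c (i : 'Z_e) : algC := (residue_count s la i)%:R.
pose g (i : 'Z_e) : algC := (count (fun x : int => x%:~R == i) (charges s))%:R.
pose h (i : 'Z_e) : algC :=
  (count (fun x : int => x%:~R == i) (charged_hooks s la))%:R.
pose one (i : 'Z_e) : algC := (i == 0)%:R.
have cE q : q ^+ e = 1 ->
    power_sum q (charged_contents s la) = \sum_(i : 'Z_e) c i * q ^+ i.
  move=> /(power_sum_residues e_gt1) ->.
  by apply: eq_bigr => i _; rewrite /c residue_countE.
have oneE (q : algC) : \sum_(i : 'Z_e) one i * q ^+ i = 1.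
  rewrite (bigD1 0) //= /one eqxx mul1r expr0 big1 ?addr0 // => i /negPf ->.
  by rewrite mul0r.
have h_one : \sum_(i : 'Z_e) h i * one i = (defect s la e)%:R.
  rewrite (bigD1 0) //= /one eqxx mulr1 big1 => [|i /negPf -> ]; last by rewrite mulr0.
  by rewrite addr0 /h; congr _%:R; apply: eq_count => x /=; rewrite intr_Zp_eq0.
have key : 2%:R * (defect s la e)%:R
    = 2%:R * (\sum_(a < l) c (s a)%:~R) - \sum_(i : 'Z_e) (c i - c (i - 1)) ^+ 2.
  (* Parseval produces a factor e on both sides. *)
  have e0 : (e%:R : algC) != 0 by rewrite pnatr_eq0 -lt0n ltnW.
  apply: (mulfI e0); rewrite mulrBr [in RHS]mulrCA.
  have -> : \sum_(a < l) c (s a)%:~R = \sum_(i : 'Z_e) g i * c i.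
    rewrite /g -(sum_by_residue c (charges s)) /charges big_map big_enum //.
  under [X in _ - _ * X]eq_bigr do rewrite expr2.
  rewrite [LHS]mulrCA ![2%:R * _]mulr_natl ![_ *+ 2]mulr2n -h_one.
  (* Each of the two equal terms becomes one of the two products exchanged by
     inverting q. *)
  rewrite -{2}(eq_bigr _ (fun i _ => mulrC (one i) (h i))).
  rewrite -{2}(eq_bigr _ (fun i _ => mulrC (c i) (g i))).
  rewrite -!(Parseval e_gt1 _ _ z_prim) -!big_split -sumrB /=.
  apply: eq_bigr => k _; rewrite !oneE mulr1 mul1r.
  rewrite -!mul_1Bq_residues // -!cE // /g /h -!power_sum_residues //.
  exact: power_sum_hooks_reciprocity.
apply: (fmorph_inj (ratr : rat -> algC)).
rewrite rmorph_nat /weight rmorphB rmorphM fmorphV /= ratr_nat !rmorph_sum /=.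
have two0 : (2%:R : algC) != 0 by rewrite pnatr_eq0.
apply: (mulfI two0); rewrite key mulrBr mulrA divff // mul1r.
congr (_ * _ - _); apply: eq_bigr => i _; first by rewrite rmorph_nat.
by rewrite rmorphXn rmorphB /= !rmorph_nat.
Qed.
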